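(* Let $C_1:f_1=0$ and $C_2:f_2=0$ be two reduced curves in $\mathbb{P}^2$ without common irreducible components, where $f_1,f_2\in S=\mathbb{C}[x,y,z]$ are homogeneous. Put $d_j=\deg f_j$ and $r_j=mdr(f_j)$ for $j=1,2$, and let $f=f_1f_2$, $d=d_1+d_2=\deg f$, $r=mdr(f)$. Let $E=x\partial_x+y\partial_y+z\partial_z$ be the Euler derivation. Then the following hold. (1) If $\delta_1\in D_0(f_1)$, then $$\delta=f_2\delta_1-\frac{\delta_1(f_2)}{d}E\in D_0(f).$$ In particular $r\le\min\{r_1+d_2,\ r_2+d_1\}$. (2) $D_0(f)\subset D(f_1)\cap D(f_2)$. More precisely, for a derivation $\delta\ne0$, one has $\delta\in D_0(f)$ if and only if $\delta$ can be written in a unique way in the form $$\delta=\frac{h}{d_1}E+\delta_1=-\frac{h}{d_2}E+\delta_2,$$ where $h\in S$ and $\delta_j\in D_0(f_j)$, $j=1,2$, are non-zero derivations. In particular $r\ge\max\{r_1,r_2\}$.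
   Context: $S=\mathbb{C}[x,y,z]$, and $Der(S)=\{a\partial_x+b\partial_y+c\partial_z: a,b,c\in S\}$ is the free $S$-module of $\mathbb{C}$-derivations of $S$. For homogeneous $g\in S$: $D(g)=\{\partial\in Der(S): \partial g\in (g)\}$ and $D_0(g)=\{\partial\in Der(S): \partial g=0\}$. These are graded $S$-modules, where $D_0(g)_s$ consists of the derivations $a\partial_x+b\partial_y+c\partial_z\in D_0(g)$ with $a,b,c\in S_s$. The invariant $mdr(g)=\min\{s\in\mathbb{N}: D_0(g)_s\ne 0\}$ is the minimal degree of a derivation killing $g$ (equivalently, of a Jacobian syzygy of $g$). *)

(* Defs.v *)
From HB Require Import structures.
From mathcomp Require Import all_boot all_order all_algebra.
From mathcomp Require Import boolp classical_sets reals.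
From mathcomp Require Import complex.
From mathcomp.multinomials Require Import mpoly.

Set Implicit Arguments.
Unset Strict Implicit.
Unset Printing Implicit Defensive.

Import GRing.Theory.

Local Open Scope classical_set_scope.
Local Open Scope ring_scope.

Section Derivations.
Variable R : realType.

Definition S := {mpoly (complex R)[3]}.

(* The row vector (a, b, c) stands for a d/dx + b d/dy + c d/dz; the S-module
   structure is that of row vectors. *)
Definition Der := 'rV[S]_3.

Definition der (delta : Der) (g : S) : S := \sum_i delta 0 i * g^`M(i).

Definition Euler : Der := \row_i 'X_i.

Definition dvd (p q : S) : Prop := exists u : S, q = u * p.

Definition D (g : S) : set Der := [set delta | dvd g (der delta g)].

Definition D0 (g : S) : set Der := [set delta | der delta g = 0].

Definition D0_deg (g : S) (s : nat) : set Der :=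
  [set delta | D0 g delta /\ forall i, delta 0 i \is s.-homog].

Definition D0_deg_neq0 (g : S) (s : nat) : Prop :=
  exists2 delta, D0_deg g s delta & delta != 0.

(* The default 0 is never used for homogeneous g, see mdrP below. *)
Definition mdr (g : S) : nat :=
  xget 0%N [set r | D0_deg_neq0 g r /\
                    forall s, D0_deg_neq0 g s -> (r <= s)%N].

(* msize is the degree plus one. *)
Definition deg (g : S) : nat := (msize g).-1.

Definition irreducible (p : S) : Prop :=
  [/\ p != 0, p \isn't a GRing.unit &
      forall a b : S, p = a * b -> a \is a GRing.unit \/ b \is a GRing.unit].

Definition reduced_curve (g : S) : Prop :=
  [/\ g \is (deg g).-homog, (0 < deg g)%N &
      forall p, irreducible p -> ~ dvd (p ^+ 2) g].

Definition no_common_component (g1 g2 : S) : Prop :=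
  forall p, irreducible p -> ~ (dvd p g1 /\ dvd p g2).

Lemma dhomog_mderiv (d : nat) (g : S) i :
  g \is d.-homog -> g^`M(i) \is d.-1.-homog.
Proof.
move=> /dhomogP hg; apply/dhomogP => m.
rewrite mcoeff_msupp mcoeff_mderiv => nz.
have /hg : (m + U_(i))%MM \in msupp g.
  by rewrite mcoeff_msupp; apply: contraNneq nz => ->; rewrite mul0rn.
by rewrite /= mdegD mdeg1 addn1 => <-.
Qed.

Lemma ex_D0_deg_neq0 (d : nat) (g : S) :
  g \is d.-homog -> exists s, D0_deg_neq0 g s.
Proof.
move=> hg; pose i1 : 'I_3 := lift ord0 ord0.
have [gx0|gx0] := eqVneq g^`M(ord0) 0.
  exists 0%N, (\row_i (i == ord0)%:R).
    split=> [|i].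
      rewrite /D0 /= /der big1 // => i _; rewrite mxE.
      by case: eqP => [->|_]; rewrite ?gx0 ?mulr0 ?mul0r.
    by rewrite mxE; case: eqP => _; rewrite ?dhomog0 ?dhomog1.
  by apply/eqP => /rowP /(_ ord0) /eqP; rewrite !mxE eqxx oner_eq0.
exists d.-1, (\row_i (if i == ord0 then g^`M(i1)
                      else if i == i1 then - g^`M(ord0) else 0)).
  split=> [|i].
    rewrite /D0 /= /der !big_ord_recl big_ord0 !mxE /= mul0r !addr0.
    by rewrite mulNr mulrC subrr.
  rewrite mxE; case: ifP => _; first exact: dhomog_mderiv.
  by case: ifP => _; rewrite ?dhomog0 // dhomogN dhomog_mderiv.
apply/eqP => /rowP /(_ i1) /eqP; rewrite !mxE /= oppr_eq0.
by rewrite (negbTE gx0).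
Qed.

Lemma mdrP (d : nat) (g : S) : g \is d.-homog ->
  D0_deg_neq0 g (mdr g) /\ forall s, D0_deg_neq0 g s -> (mdr g <= s)%N.
Proof.
move=> /ex_D0_deg_neq0 [s0 hs0].
have ex : exists s, `[< D0_deg_neq0 g s >] by exists s0; apply/asboolP.
rewrite /mdr; case: xgetP => [r -> []//|/(_ (ex_minn ex))]; case.
by case: ex_minnP => r /asboolP hr min; split=> // s /asboolP /min.
Qed.

End Derivations.

(* Main.v *)
(* If delta kills f1 f2 then f2 delta(f1) = - f1 delta(f2); as f1 and f2 are
   coprime in the factorial ring C[x,y,z], f1 divides delta(f1), so
   delta(f1) = h f1 and delta(f2) = - h f2. By Euler's identity E(f_j) = d_j f_j,
   subtracting the multiples (h/d_1) E and -(h/d_2) E of E from delta gives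
   derivations killing f1 and f2, which determines the decomposition. They are
   non-zero because no non-zero multiple of E kills f. *)
Require Import Defs.
From HB Require Import structures.
From mathcomp Require Import all_boot all_order all_algebra.
From mathcomp Require Import boolp classical_sets reals.
From mathcomp Require Import complex zify.
From mathcomp.multinomials Require Import mpoly.

Set Implicit Arguments.
Unset Strict Implicit.
Unset Printing Implicit Defensive.

Import GRing.Theory.

Local Open Scope classical_set_scope.
Local Open Scope ring_scope.

(** * Factoriality of polynomial rings *)

Section FactorialRings.
Variable A : idomainType.
Implicit Types a b c p : A.

Definition divides p a : Prop := exists u, a = u * p.

Lemma divides_sub a b c : divides a (b + c) -> divides a c -> divides a b.
Proof. by move=> [u e] [v cE]; exists (u - v); rewrite mulrBl -e cE addrK. Qed.

Lemma dividesMl a b c : divides a b -> divides a (c * b).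
Proof. by move=> [u ->]; exists (c * u); rewrite mulrA. Qed.

Definition prime_element p : Prop :=
  [/\ p != 0, p \isn't a GRing.unit &
      forall a b, divides p (a * b) -> divides p a \/ divides p b].

Inductive prime_product : A -> Prop :=
| PrimeProductUnit u : u \is a GRing.unit -> prime_product u
| PrimeProductCons p a :
    prime_element p -> prime_product a -> prime_product (p * a).

(** Factoring into primes rather than irreducibles makes uniqueness automatic, so only existence has
    to be carried to polynomial rings. *)
Definition factorial : Prop := forall a, a != 0 -> prime_product a.

Lemma prime_productM a b :
  prime_product a -> prime_product b -> prime_product (a * b).
Proof.
move=> ha hb; elim: ha => [u hu|p a' hp _ ih].
  elim: hb => [v hv|p c hp _ ih].
    by apply: PrimeProductUnit; rewrite unitrM hu.
  by rewrite mulrCA; apply: PrimeProductCons.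
by rewrite -mulrA; apply: PrimeProductCons.
Qed.

Lemma prime_element_product p : prime_element p -> prime_product p.
Proof.
move=> hp; rewrite -[p]mulr1; apply: PrimeProductCons => //.
exact/PrimeProductUnit/unitr1.
Qed.

(** Common components are excluded through irreducible polynomials, while factorizations are into
    primes; this links the two. *)
Lemma prime_element_irreducible p a b :
  prime_element p -> p = a * b -> a \is a GRing.unit \/ b \is a GRing.unit.
Proof.
move=> [p0 _ hp] pE.
have unit_of_cofactor s c : p = s * p * c -> c \is a GRing.unit.
  move=> e; apply/unitrP; exists s.
  suff sc : s * c = 1 by rewrite [c * s]mulrC.
  by apply: (mulIf p0); rewrite mul1r mulrAC -e.
have [|[s aE]|[s bE]] := hp a b; first by exists 1; rewrite mul1r.
  by right; apply: (unit_of_cofactor s); rewrite -aE.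
by left; apply: (unit_of_cofactor s); rewrite -bE mulrC.
Qed.

(** Induction on the factorization of [a]: each prime of [a] divides [b * c] but not [b], hence
    divides [c], and is cancelled on both sides. *)
Lemma factorial_coprime_divides a b c : factorial -> a != 0 ->
  (forall p, prime_element p -> ~ (divides p a /\ divides p b)) ->
  divides a (b * c) -> divides a c.
Proof.
move=> fact /fact ha; elim: ha c => [u hu|p a' hp _ ih] c co.
  by move=> _; exists (c / u); rewrite divrK.
move=> [s e]; have [p0 _ pP] := hp.
have /pP [pb|[c' cE]] : divides p (b * c).
    by exists (s * a'); rewrite e mulrCA mulrC.
  by case: (co p hp); split=> //; exists a'; rewrite mulrC.
have [||t tE] := ih c'.
- move=> q hq [[v qa] qb]; case: (co q hq); split=> //.
  by exists (p * v); rewrite qa mulrA.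
- exists s; apply: (mulIf p0); rewrite -mulrA -cE e.
  by rewrite -mulrA; congr (_ * _); rewrite mulrC.
by exists t; rewrite cE tE -mulrA (mulrC p).
Qed.

End FactorialRings.

Lemma factorial_iso (A B : idomainType)
    (f : {rmorphism A -> B}) (g : {rmorphism B -> A}) :
  cancel f g -> cancel g f -> factorial B -> factorial A.
Proof.
move=> fK gK fact a a0.
have /fact : f a != 0.
  by apply: contra_neq a0 => fa0; rewrite -[a]fK fa0 rmorph0.
rewrite -{2}[a]fK; elim=> [u hu|p b [p0 nu pP] _ ih].
  by apply: PrimeProductUnit; rewrite rmorph_unit.
rewrite rmorphM; apply: PrimeProductCons => //.
have divides_g x : divides p (f x) <-> divides (g p) x.
  split=> [[u e]|[u ->]]; first by exists (g u); rewrite -rmorphM -e fK.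
  by exists (f u); rewrite rmorphM gK.
split.
- by apply: contra_neq p0 => gp0; rewrite -[p]gK gp0 rmorph0.
- by apply: contra nu => gu; rewrite -[p]gK rmorph_unit.
- by move=> x y /divides_g; rewrite rmorphM => /pP [] /divides_g; [left|right].
Qed.

(** * Gauss's theorem: polynomials over a factorial ring *)

Section PolynomialFactorial.
Variable A : idomainType.
Implicit Types (a b c p : A) (f g h q w : {poly A}).

Lemma dividesCP p f :
  divides p%:P f <-> forall i, divides p f`_i.
Proof.
split=> [[u ->] i|/choice [u uE]]; first by exists u`_i; rewrite coefMC.
exists (\poly_(i < size f) u i); apply/polyP => i; rewrite coefMC coef_poly.
by case: ltnP => [_|hi]; [exact: uE|rewrite mul0r nth_default].
Qed.

Lemma dividesC_MXaddC p f c :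
  divides p%:P (f * 'X + c%:P) <-> divides p%:P f /\ divides p c.
Proof.
split=> [/dividesCP h|[/dividesCP hf hc]].
  split; last by have := h 0; rewrite coefD coefMX coefC /= add0r.
  by apply/dividesCP => i; have := h i.+1; rewrite coefD coefMX coefC addr0.
by apply/dividesCP => -[|i]; rewrite coefD coefMX coefC /= ?add0r ?addr0.
Qed.

Lemma dividesC_MX p f : divides p%:P (f * 'X) -> divides p%:P f.
Proof. by rewrite -[f * 'X]addr0 => /dividesC_MXaddC []. Qed.

Lemma dividesCC p c : divides p c -> divides p%:P c%:P.
Proof. by move=> [u ->]; exists u%:P; rewrite polyCM. Qed.

(** [p] divides the product of the constant terms, hence one of them; removing that term and a
    factor ['X] leaves a shorter factor. *)
Lemma polyC_prime p : prime_element p -> prime_element p%:P.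
Proof.
move=> [p0 pu pP]; split; first by rewrite polyC_eq0.
  by rewrite poly_unitE coefC size_polyC p0.
elim/poly_ind=> [|f c ihf]; first by left; exists 0; rewrite mul0r.
elim/poly_ind=> [|g d ihg] pfg; first by right; exists 0; rewrite mul0r.
have /pP : divides p (c * d).
  move/dividesCP/(_ 0): (pfg).
  by rewrite coef0M !coefD !coefMX !coefC /= !add0r.
case=> [pc|pd].
  have : divides p%:P (f * (g * 'X + d%:P) * 'X).
    apply: (@divides_sub _ _ _ (c%:P * (g * 'X + d%:P))).
      by rewrite mulrAC -mulrDl.
    by rewrite mulrC; apply/dividesMl/dividesCC.
  move/dividesC_MX/ihf => [pf|]; [left|by right].
  by apply/dividesC_MXaddC.
have : divides p%:P ((f * 'X + c%:P) * g * 'X).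
  apply: (@divides_sub _ _ _ ((f * 'X + c%:P) * d%:P)).
    by rewrite -mulrA -mulrDr.
  exact/dividesMl/dividesCC.
move/dividesC_MX/ihg => [|pg]; [by left|right].
by apply/dividesC_MXaddC.
Qed.

(* Gauss's lemma: the primes of [a] stay prime in [A[X]], so each of them can
   be moved into [q] or into [w]. *)
Lemma constant_factor_split a f q w : prime_product a ->
  a%:P * f = q * w ->
  exists b c q' w', [/\ q = b%:P * q', w = c%:P * w' & f = q' * w'].
Proof.
move=> ha; elim: ha q w => [u hu|p {}a hp _ ih] q w e.
  exists u, 1, ((u^-1)%:P * q), w; split; rewrite ?mul1r //.
    by rewrite mulrA -polyCM divrr // mul1r.
  by rewrite -mulrA -e mulrA -polyCM mulVr // mul1r.
have [p0 _ pP] := polyC_prime hp.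
have /pP [[s sE]|[s sE]] : divides p%:P (q * w).
  by exists (a%:P * f); rewrite -e polyCM -mulrA mulrC.
- have [|b [c [q' [w' [qE wE fE]]]]] := ih s w.
    by apply: (mulfI p0); rewrite mulrA -polyCM e sE mulrA (mulrC s).
  by exists (p * b), c, q', w'; split=> //; rewrite sE qE polyCM mulrC mulrA.
- have [|b [c [q' [w' [qE wE fE]]]]] := ih q s.
    by apply: (mulfI p0); rewrite mulrA -polyCM e sE mulrA mulrC.
  by exists b, (p * c), q', w'; split=> //; rewrite sE wE polyCM mulrC mulrA.
Qed.

(** Unit content, expressed by constant divisors to avoid gcds of coefficients. *)
Definition primitive f : Prop := forall c, divides c%:P f -> c \is a GRing.unit.

Lemma primitive_factor f q w : primitive f -> f = q * w -> primitive q.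
Proof.
move=> prim fE c [u qE]; apply: prim; exists (u * w).
by rewrite fE qE mulrAC.
Qed.

Hypothesis factA : factorial A.

(* [%|] is pseudo-divisibility, i.e. divisibility over the fraction field. *)
Lemma primitive_divides f g : primitive f -> f %| g -> divides f g.
Proof.
move=> prim /Pdiv.WeakIdomain.dvdpP [[a q] /= a0 e].
have [|b [c [q' [f' [_ fE gE]]]]] := @constant_factor_split a g q f (factA a0).
  by rewrite mul_polyC.
have cu : c \is a GRing.unit by apply: prim; exists f'; rewrite mulrC.
exists (q' * (c^-1)%:P).
by rewrite fE gE -mulrA; congr (_ * _); rewrite mulrA -polyCM mulVr // mul1r.
Qed.

(** [irreducible_poly] refers to pseudo-divisibility, so a gcd argument over the fraction field
    applies; primitivity brings the division back to the ring. *)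
Lemma primitive_irreducible_prime f :
  primitive f -> irreducible_poly f -> prime_element f.
Proof.
move=> prim irr; split; first exact: irredp_neq0.
  by rewrite poly_unitE; case: irr => s1 _; case: eqP => // s; rewrite s in s1.
move=> g h [u e].
have fgh : f %| g * h by rewrite e dvdp_mull.
have [co|nco] := boolP (coprimep f g).
  by right; apply: primitive_divides => //; rewrite -(Gauss_dvdpr _ co).
left; apply: primitive_divides => //.
have := irr.2 _ nco (dvdp_gcdl f g); rewrite eqp_sym => /eqp_dvdl ->.
exact: dvdp_gcdr.
Qed.

(** Strong induction on the size: a proper divisor over the fraction field yields, after clearing
    constants, two smaller primitive factors. *)
Lemma primitive_prime_product f : primitive f -> prime_product f.
Proof.
have [n] := ubnP (size f); elim: n f => // n ih f; rewrite ltnS => fn prim.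
have [f1|f1] := leqP (size f) 1.
  have fC := size1_polyC f1; apply: PrimeProductUnit.
  have fu : f`_0 \is a GRing.unit by apply: prim; exists 1; rewrite mul1r.
  by rewrite fC rmorph_unit.
have [irr|nirr] := pselect (irreducible_poly f).
  exact/prime_element_product/primitive_irreducible_prime.
have f0 : f != 0 by rewrite -size_poly_gt0 ltnW.
have [q [q1 qf nqf]] : exists q, [/\ size q != 1, q %| f & ~~ (q %= f)].
  apply: contrapT => nex; apply: nirr; split=> // q q1 qf.
  by apply: contrapT => /negP nqf; apply: nex; exists q.
have /Pdiv.WeakIdomain.dvdpP [[a s] /= a0 e] := qf.
have [|b [c [s' [q' [sE qE fE]]]]] :=
  @constant_factor_split a f s q (factA a0); first by rewrite mul_polyC.
have := f0; rewrite fE mulf_eq0 negb_or => /andP [s'0 q'0].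
have q0 : q != 0 by apply: contraTneq qf => ->; rewrite dvd0p.
have c0 : c != 0 by apply: contra_neq q0 => c0; rewrite qE c0 mul0r.
have size_q : size q' = size q by rewrite qE mul_polyC size_scale.
have q'1 : (1 < size q')%N.
  by rewrite size_q ltn_neqAle eq_sym q1 size_poly_gt0.
(* A constant cofactor would make [q] associated to [f] over the fraction field. *)
have s'1 : (1 < size s')%N.
  rewrite ltnNge; apply: contra nqf => /size1_polyC s'C.
  have d0 : s'`_0 != 0 by apply: contra_neq s'0 => d0; rewrite s'C d0.
  apply/eqpP; exists (s'`_0, c); rewrite /= ?d0 //.
  by rewrite qE fE {2}s'C !mul_polyC !scalerA mulrC.
have size_f : size f = (size s' + size q').-1 by rewrite fE size_mul.
apply: prime_productM; apply: ih.
- by move: q'1 s'1 fn; rewrite size_f; case: (size q') => [|[|k]] //; lia.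
- exact: primitive_factor prim fE.
- by move: q'1 s'1 fn; rewrite size_f; lia.
- by apply: primitive_factor prim _; rewrite fE mulrC.
Qed.

Lemma content_primitive_part f :
  f != 0 -> exists c g, f = c%:P * g /\ primitive g.
Proof.
move=> f0.
(* Induct on the factorization of a bound [a] for the constant divisors. *)
suff content a : prime_product a -> forall g,
    (forall c, divides c%:P g -> divides c a) ->
    exists c h, g = c%:P * h /\ primitive h.
  (* Every constant divisor of [f] divides its leading coefficient, which serves as the first
     bound. *)
  apply: (content (lead_coef f)); first by apply: factA; rewrite lead_coef_eq0.
  by move=> c [u ->]; exists (lead_coef u); rewrite lead_coefM lead_coefC.
elim=> [u hu|p {}a hp _ ih] g ga.
  exists 1, g; split=> [|c /ga [v e]]; first by rewrite mul1r.
  by move: hu; rewrite e unitrM => /andP [].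
have [p0 _ pP] := hp.
have [[h hE]|npg] := pselect (divides p%:P g).
  have [|c [k [kE prim]]] := ih h.
    move=> c [u uE]; have [|v vE] := ga (c * p).
      by exists u; rewrite hE uE polyCM mulrA.
    by exists v; apply: (mulfI p0); rewrite vE mulrA mulrC.
  by exists (p * c), k; split=> //; rewrite hE kE polyCM mulrC mulrA.
(* As [p] does not divide [g], it does not divide [c]; so it divides [u] in [p * a = u * c] and
   cancels, and [a] is already a bound. *)
apply: ih => c cg; have [u uE] := ga c cg.
have /pP [[v vE]|[v vE]] : divides p (u * c) by exists a; rewrite -uE mulrC.
  by exists v; apply: (mulfI p0); rewrite uE vE mulrA (mulrC v).
case: npg; case: cg => w ->; exists (w * v%:P).
by rewrite vE polyCM mulrA.
Qed.

Lemma factorial_poly : factorial {poly A}.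
Proof.
move=> f f0; have [c [g [fE prim]]] := content_primitive_part f0.
rewrite fE; apply: prime_productM; last exact: primitive_prime_product.
have /factA : c != 0 by apply: contra_neq f0 => c0; rewrite fE c0 mul0r.
elim=> [u hu|p a hp _ ih].
  by apply: PrimeProductUnit; rewrite rmorph_unit.
by rewrite polyCM; apply: PrimeProductCons => //; apply: polyC_prime.
Qed.

End PolynomialFactorial.

(** * Passage to several variables, one variable at a time *)

Section MultivariateFactorial.
Variable F : fieldType.

(** The inverse of [muni]: the polynomial indeterminate becomes the last variable. *)
Definition multi n (p : {poly {mpoly F[n]}}) : {mpoly F[n.+1]} :=
  (map_poly (@mwiden n F) p).['X_ord_max].

Lemma multi_is_zmod_morphism n : zmod_morphism (@multi n).
Proof. by move=> p q; rewrite /multi raddfB hornerD hornerN. Qed.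

Lemma multi_is_monoid_morphism n : monoid_morphism (@multi n).
Proof.
by split=> [|p q]; rewrite /multi ?rmorph1 ?hornerC // rmorphM hornerM.
Qed.

HB.instance Definition _ n :=
  GRing.isZmodMorphism.Build _ _ (@multi n) (@multi_is_zmod_morphism n).
HB.instance Definition _ n :=
  GRing.isMonoidMorphism.Build _ _ (@multi n) (@multi_is_monoid_morphism n).

Lemma multi_monomial n (q : {mpoly F[n]}) k :
  multi (q *: 'X^k) = mwiden q * 'X_ord_max ^+ k.
Proof. by rewrite /multi map_polyZ hornerZ map_polyXn hornerXn. Qed.

Lemma muniK n : cancel (@muni n F) (@multi n).
Proof.
move=> p; rewrite muniE rmorph_sum [RHS]mpolyE; apply: eq_bigr => m _ /=.
rewrite multi_monomial mwidenZ mwidenX -scalerAl; congr (_ *: _).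
rewrite mpolyXn -mpolyXD; congr 'X_[_]; apply/mnmP => i.
rewrite mnmDE mulmnE mnm1E; have [j ->|->] := unliftP ord_max i; last first.
  by rewrite mnmwiden_ordmax eqxx mul1n add0n.
have -> : lift ord_max j = widen_ord (leqnSn n) j.
  by apply/val_inj; rewrite /= /bump leqNgt ltn_ord.
rewrite mnmwiden_widen mnmE -val_eqE /= gtn_eqF //.
by rewrite mul0n addn0.
Qed.

Lemma muni_mwiden n (q : {mpoly F[n]}) : muni (mwiden q) = q%:P.
Proof.
rewrite [q]mpolyE (raddf_sum (@mwiden n F)) (raddf_sum (@muni n F)) raddf_sum.
apply: eq_bigr => m _ /=.
rewrite mwidenZ mwidenX muniZ muniE msuppX big_seq1 mcoeffX eqxx scale1r.
rewrite mnmwiden_ordmax expr0 alg_polyC -mul_polyC -polyCM mul_mpolyC.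
by do 3 congr (_ _); apply/mnmP => i; rewrite mnmE mnmwiden_widen.
Qed.

Lemma muni_Xmax n : muni 'X_ord_max = 'X :> {poly {mpoly F[n]}}.
Proof.
rewrite muniE msuppX big_seq1 mcoeffX eqxx scale1r mnm1E eqxx expr1.
rewrite (_ : [multinom _ | i < n] = 0%MM) ?mpolyX0 ?scale1r //.
by apply/mnmP => i; rewrite mnmE mnm1E mnm0E -val_eqE /= gtn_eqF.
Qed.

Lemma multiK n : cancel (@multi n) (@muni n F).
Proof.
elim/poly_ind=> [|p c ih]; first by rewrite !rmorph0.
rewrite rmorphD rmorphM /= muniD muniM ih.
have -> : multi 'X = 'X_ord_max :> {mpoly F[n.+1]}.
  by rewrite -[multi _]mul1r /multi map_polyX hornerX mul1r.
by rewrite muni_Xmax /multi map_polyC hornerC /= muni_mwiden.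
Qed.

(** Induction on the number of variables; with none, every non-zero polynomial is a constant of [F],
    hence a unit. *)
Lemma factorial_mpoly n : factorial {mpoly F[n]}.
Proof.
elim: n => [|n ih]; last first.
  exact: factorial_iso (@muniK n) (@multiK n) (factorial_poly ih).
move=> p p0; apply: PrimeProductUnit.
have pC : p = (p@_0)%:MP.
  apply/mpolyP => m; rewrite mcoeffC.
  have -> : m = 0%MM by apply/mnmP; case.
  by rewrite eqxx mulr1.
rewrite pC rmorph_unit // unitfE; apply: contra_neq p0 => c0.
by rewrite pC c0.
Qed.

End MultivariateFactorial.

(** * Derivations killing a product *)

Section JacobianDerivations.
Variable R : realType.
Implicit Types (g h : S R) (delta : Der R).

Lemma derD delta delta' g : der (delta + delta') g = der delta g + der delta' g.
Proof.
by rewrite /der -big_split; apply: eq_bigr => i _; rewrite mxE mulrDl.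
Qed.

Lemma derZ h delta g : der (h *: delta) g = h * der delta g.
Proof.
by rewrite /der big_distrr; apply: eq_bigr => i _ /=; rewrite mxE mulrA.
Qed.

Lemma der_mul delta g h : der delta (g * h) = der delta g * h + g * der delta h.
Proof.
rewrite /der big_distrl big_distrr -big_split; apply: eq_bigr => i _ /=.
by rewrite mderivM mulrDr; congr (_ + _); [exact: mulrA|exact: mulrCA].
Qed.

(** Euler's identity, checked on monomials: the [i]-th term multiplies ['X_[m]] by [m i], and these
    exponents add up to the degree. *)
Lemma der_Euler d g : g \is d.-homog -> der (Euler R) g = d%:R *: g.
Proof.
move=> /dhomogP hg; rewrite /der [in RHS](mpolyE g) scaler_sumr.
rewrite (eq_bigr (fun i => \sum_(m <- msupp g)
  ((m i)%:R * g@_m) *: 'X_[m])) => [|i _].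
  rewrite exchange_big; apply: eq_big_seq => m /hg <- /=.
  rewrite scalerA -scaler_suml -mulr_suml; congr (_ * _ *: _).
  by rewrite mdegE natr_sum.
rewrite mxE {1}(mpolyE g) raddf_sum big_distrr; apply: eq_bigr => m _ /=.
rewrite mderivZ mderivX -!scalerAr scalerA mulrC.
(* Subtraction of exponents truncates when [m i = 0]; there the coefficient is zero. *)
have [->|mi] := eqVneq (m i) 0%N.
  by rewrite mulr0n !(mul0r, mulr0) !scale0r.
rewrite mulrC -mpolyXD addmC submK ?[_ * g@_m]mulrC //.
apply/mnm_lepP => j; rewrite mnm1E; case: eqP => [<-|] //.
by rewrite lt0n.
Qed.

Lemma der_homog delta g s d : (0 < d)%N ->
  (forall i, delta 0 i \is s.-homog) -> g \is d.-homog ->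
  der delta g \is (s + d).-1.-homog.
Proof.
move=> d0 hd hg; apply: rpred_sum => i _.
by rewrite -{1}(prednK d0) addnS; apply: dhomogM; rewrite ?hd ?dhomog_mderiv.
Qed.

Lemma complex_natr_neq0 n : (0 < n)%N -> (n%:R : complex R) != 0.
Proof. by rewrite Num.Theory.pnatr_eq0 lt0n. Qed.

Lemma homog_deg_neq0 g : (0 < deg g)%N -> g != 0.
Proof. by apply: contraTneq => ->; rewrite /deg msize0. Qed.

Lemma degM g h : g != 0 -> h != 0 -> deg (g * h) = (deg g + deg h)%N.
Proof.
move=> g0 h0; rewrite /deg msizeM //.
by rewrite (mpolySpred _ g0) (mpolySpred _ h0) addnS.
Qed.

Lemma pihomogM k d h g : g \is d.-homog ->
  pihomog mdeg (k + d) (h * g) = pihomog mdeg k h * g.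
Proof.
move=> hg; rewrite (pihomog_partitionE (leqnn (mmeasure mdeg h))).
rewrite mulr_suml !raddf_sum /= mulr_suml; apply: eq_bigr => j _.
have hj := pihomogP mdeg j h.
have hjg : pihomog mdeg j h * g \is (j + d).-homog by apply: dhomogM.
have [<-|jk] := eqVneq (j : nat) k.
  by rewrite (pihomog_dE hjg) (pihomog_dE hj).
by rewrite (pihomog_ne0 _ hjg) ?eqn_add2r // (pihomog_ne0 _ hj) // mul0r.
Qed.

(** A component of [h] of degree other than [k] becomes, times [g], a vanishing component of
    [h * g], so it is zero. *)
Lemma dhomog_divr k d h g : g != 0 -> g \is d.-homog ->
  h * g \is (k + d).-homog -> h \is k.-homog.
Proof.
move=> g0 hg hhg; rewrite (pihomog_partitionE (leqnn (mmeasure mdeg h))).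
apply: rpred_sum => j _; have [<-|jk] := eqVneq (j : nat) k.
  exact: pihomogP.
suff -> : pihomog mdeg j h = 0 by apply: dhomog0.
apply: (mulIf g0); rewrite -(pihomogM _ _ hg) mul0r.
by rewrite (pihomog_ne0 _ hhg) // eqn_add2r eq_sym.
Qed.

Lemma D0_Euler_multiple d g h : g != 0 -> g \is d.-homog -> (0 < d)%N ->
  D0 g (h *: Euler R) -> h = 0.
Proof.
move=> g0 hg d0; rewrite /D0 /= derZ (der_Euler hg) -scalerAr => /eqP.
rewrite scaler_eq0 (negbTE (complex_natr_neq0 d0)) /= mulf_eq0 (negbTE g0) orbF.
by move/eqP.
Qed.

Lemma der_Euler_part d g h delta : g \is d.-homog -> (0 < d)%N ->
  der (((d%:R : complex R)^-1 *: h) *: Euler R + delta) g = h * g + der delta g.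
Proof.
move=> hg d0; rewrite derD derZ (der_Euler hg) -scalerAl -scalerAr scalerA.
by rewrite mulVf ?complex_natr_neq0 // scale1r.
Qed.

(** The Euler derivation divided by [d] fixes [g], hence the constants in the theorem. This
    correction yields both the lift to the product and the two parts of the decomposition. *)
Lemma D0_sub_Euler d g h delta : g \is d.-homog -> (0 < d)%N ->
  der delta g = h * g ->
  D0 g (delta - ((d%:R : complex R)^-1 *: h) *: Euler R).
Proof.
move=> hg d0 e; rewrite /D0 /= addrC -scaleNr -scalerN (der_Euler_part _ _ hg) //.
by rewrite e mulNr addNr.
Qed.

(** [g2 *: delta] multiplies [g1 * g2] by [der delta g2], and the Euler term removes exactly this
    cofactor. *)
Lemma D0_mul_lift g1 g2 delta d :
  (0 < d)%N -> g1 * g2 \is d.-homog -> D0 g1 delta ->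
  D0 (g1 * g2)
     (g2 *: delta - ((d%:R : complex R)^-1 *: der delta g2) *: Euler R).
Proof.
move=> d0 hg d1; apply: (D0_sub_Euler hg d0).
rewrite derZ der_mul d1 mul0r add0r mulrCA [RHS]mulrCA.
by congr (_ * _); exact: mulrC.
Qed.

Lemma D0_mul_split g1 g2 delta : no_common_component g1 g2 ->
  g1 != 0 -> g2 != 0 -> D0 (g1 * g2) delta ->
  exists h, der delta g1 = h * g1 /\ der delta g2 = - h * g2.
Proof.
move=> co g10 g20; rewrite /D0 /= der_mul => e.
have [h hE] : divides g1 (der delta g1).
  apply: (@factorial_coprime_divides _ g1 g2) => //.
  - exact: factorial_mpoly.
  - move=> p hp; apply: co; have [p0 pu _] := hp; split=> // a b.
    exact: prime_element_irreducible.
  - exists (- der delta g2); rewrite mulNr; apply/eqP.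
    by rewrite -addr_eq0 [g2 * _]mulrC [X in _ + X]mulrC e.
(* Cancelling [g1] in the product rule forces the opposite cofactor for [g2]. *)
exists h; split=> //; apply: (mulfI g10); apply/eqP.
by rewrite -subr_eq0 mulNr mulrN opprK addrC mulrA (mulrC g1) -hE e.
Qed.

(** * Bounds on the minimal degree of a killing derivation *)

Lemma mdr_le d g s : g \is d.-homog -> D0_deg_neq0 g s -> (mdr g <= s)%N.
Proof. by move=> /mdrP [_]; apply. Qed.

Lemma mdr_mul_le d1 d2 g1 g2 : g1 != 0 -> g2 != 0 ->
  g1 \is d1.-homog -> g2 \is d2.-homog -> (0 < d1)%N -> (0 < d2)%N ->
  (mdr (g1 * g2)%R <= mdr g1 + d2)%N.
Proof.
move=> g10 g20 h1 h2 d10 d20.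
have hg : g1 * g2 \is (d1 + d2).-homog by apply: dhomogM.
have d0 : (0 < d1 + d2)%N by rewrite addn_gt0 d10.
have [[delta [dD hd] nz] _] := mdrP h1.
apply: (mdr_le hg).
exists (g2 *: delta -
        (((d1 + d2)%:R : complex R)^-1 *: der delta g2) *: Euler R).
  split=> [|i]; first exact: D0_mul_lift.
  rewrite !mxE; apply: rpredB; first by rewrite addnC; apply: dhomogM.
  rewrite -scalerAl; apply: rpredZ.
  (* Differentiating [g2] loses one degree, which the linear coefficients of the Euler derivation
     restore. *)
  have -> : (mdr g1 + d2 = (mdr g1 + d2).-1 + 1)%N.
    by rewrite addn1 prednK // addn_gt0 d20 orbT.
  by apply: dhomogM; rewrite ?der_homog // dhomogX /= mdeg1.
(* If the lift vanished, [g2 *: delta] would be a multiple of the Euler derivation killing [g1]; the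
   multiplier, and then [delta], would be zero. *)
apply: contra_neq nz => /subr0_eq e.
have c0 : ((d1 + d2)%:R : complex R)^-1 *: der delta g2 = 0.
  by apply: (D0_Euler_multiple g10 h1 d10); rewrite -e /D0 /= derZ dD mulr0.
apply/rowP => i; apply: (mulfI g20).
by move/rowP/(_ i): e; rewrite c0 scale0r !mxE mulr0.
Qed.

(** A minimal derivation killing the product, corrected by an Euler multiple, kills [g1] and keeps
    its degree. *)
Lemma mdr_le_mul d1 d2 g1 g2 : no_common_component g1 g2 ->
  g1 != 0 -> g2 != 0 ->
  g1 \is d1.-homog -> g2 \is d2.-homog -> (0 < d1)%N ->
  (mdr g1 <= mdr (g1 * g2)%R)%N.
Proof.
move=> co g10 g20 h1 h2 d10.
have hg : g1 * g2 \is (d1 + d2).-homog by apply: dhomogM.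
have [[delta [dD hd] nz] _] := mdrP hg.
have [h [hE _]] := D0_mul_split co g10 g20 dD.
apply: (mdr_le h1).
exists (delta - ((d1%:R : complex R)^-1 *: h) *: Euler R).
  split=> [|i]; first exact: D0_sub_Euler.
  rewrite !mxE; apply: rpredB => //; rewrite -scalerAl; apply: rpredZ.
  (* [h] is only known through [h * g1 = der delta g1]; multiplying by 'X_i
     first avoids the degree of [h], which is -1 for constant [delta]. *)
  apply: (dhomog_divr g10 h1); rewrite mulrAC -hE.
  have -> : (mdr (g1 * g2)%R + d1 = (mdr (g1 * g2)%R + d1).-1 + 1)%N.
    by rewrite addn1 prednK // addn_gt0 d10 orbT.
  by apply: dhomogM; rewrite ?der_homog // dhomogX /= mdeg1.
apply: contra_neq nz => /subr0_eq e; rewrite e in dD *.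
have d0 : (0 < d1 + d2)%N by rewrite addn_gt0 d10.
by rewrite (D0_Euler_multiple _ hg d0 dD) ?mulf_neq0 ?scale0r.
Qed.

End JacobianDerivations.

Theorem theorem5p1 (R : realType) (f1 f2 : S R) :
  reduced_curve f1 -> reduced_curve f2 -> no_common_component f1 f2 ->
  let d1 := deg f1 in let d2 := deg f2 in
  let r1 := mdr f1 in let r2 := mdr f2 in
  let f : S R := f1 * f2 in let d := deg f in let r := mdr f in
  let E : Der R := Euler R in
  [/\ d = (d1 + d2)%N,
      (forall delta1 : Der R, D0 f1 delta1 ->
         D0 f (f2 *: delta1 - ((d%:R : complex R)^-1 *: der delta1 f2) *: E))
      /\ (r <= minn (r1 + d2) (r2 + d1))%N
    & [/\ D0 f `<=` D f1 `&` D f2,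
          forall delta : Der R, delta != 0 ->
            (D0 f delta <->
             exists! t : S R * Der R * Der R,
               let: (h, delta1, delta2) := t in
               [/\ D0 f1 delta1 /\ delta1 != 0,
                   D0 f2 delta2 /\ delta2 != 0,
                   delta = ((d1%:R : complex R)^-1 *: h) *: E + delta1
                 & delta = - (((d2%:R : complex R)^-1 *: h) *: E) + delta2])
        & (maxn r1 r2 <= r)%N]].
Proof.
move=> [h1 d10 _] [h2 d20 _] co d1 d2 r1 r2 f d r E.
have f10 := homog_deg_neq0 d10; have f20 := homog_deg_neq0 d20.
have dE : d = (d1 + d2)%N by apply: degM.
have d0 : (0 < d)%N by rewrite dE addn_gt0 d10.
have hf : f \is d.-homog by rewrite dE; apply: dhomogM.
have co' : no_common_component f2 f1 by move=> p hp [p2 p1]; apply: (co p hp).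
have nonzero_sub c delta : D0 f delta -> delta != 0 -> delta - c *: E != 0.
  move=> dD; apply: contra_neq => /subr0_eq e; rewrite e in dD *.
  by rewrite (D0_Euler_multiple _ hf d0 dD) ?mulf_neq0 ?scale0r.
split=> //; split.
- by move=> delta1; apply: D0_mul_lift.
- rewrite leq_min (mdr_mul_le f10 f20 h1 h2 d10 d20) /=.
  by rewrite /r /f mulrC (mdr_mul_le f20 f10 h2 h1 d20 d10).
- move=> delta /(D0_mul_split co f10 f20) [h [e1 e2]].
  by split; [exists h|exists (- h)].
- move=> delta nz; split=> [dD|[[[h delta1] delta2]]]; last first.
    (* The first expression is evaluated on [f1], the second on [f2]; the values [h * f1] and
       [- h * f2] cancel in the product rule. *)
    move=> [[[D1 _] [D2 _] e1 e2] _]; rewrite /D0 /= der_mul.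
    rewrite {1}e1 e2 -scaleNr -scalerN (der_Euler_part _ _ h1) //.
    rewrite (der_Euler_part _ _ h2) // D1 D2 !addr0.
    by rewrite mulrCA mulNr mulrA subrr.
  have [h [e1 e2]] := D0_mul_split co f10 f20 dD.
  exists (h, delta - ((d1%:R : complex R)^-1 *: h) *: E,
             delta + ((d2%:R : complex R)^-1 *: h) *: E); split.
    split.
    + by split; [exact: D0_sub_Euler|exact: nonzero_sub].
    (* Rewriting the sum as a difference puts it in the form of the correction with cofactor
       [- h]. *)
    + rewrite -[X in delta + X]opprK -scaleNr -[- (_ *: h)]scalerN.
      by split; [exact: D0_sub_Euler|exact: nonzero_sub].
    + by rewrite addrC subrK.
    + by rewrite addrC addrK.
  move=> [[h' delta1] delta2] [[D1 _] _ E1 E2].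
  (* Evaluating [delta] on [f1] recovers the multiplier, which then fixes both derivations. *)
  have hh : h = h'.
    by apply: (mulIf f10); rewrite -e1 E1 (der_Euler_part _ _ h1) // D1 addr0.
  congr (_, _, _); rewrite hh //.
    by rewrite {1}E1 addrC addKr.
  by rewrite {1}E2 addrC addNKr.
- rewrite geq_max (mdr_le_mul co f10 f20 h1 h2) //=.
  by rewrite /r /f mulrC (mdr_le_mul co' f20 f10 h2 h1).
Qed.
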